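(* Let $\phi:\mathbb{R}^n\to\overline{\mathbb{R}}$ be a reference function that is $2$-subhomogeneous, and let $f\in\mathcal{C}^1(\mathbb{R}^n)$ be anisotropically smooth relative to $\phi$ with constant $L>0$ and satisfy $f_\star=\inf f>-\infty$. Suppose that $f$ satisfies the anisotropic gradient dominance condition relative to $\phi$ with constant $\mu>0$. Let $\beta\in(0,0.5)$ and $0<\gamma\le\frac1L$, let $x^0\in\mathbb{R}^n$, $m^{-1}=0$, and let $\{x^k\}_{k\in\mathbb{N}_0}$ be generated for $k=0,1,\dots$ by $$m^k=\beta m^{k-1}+(1-\beta)\nabla\phi^*(\nabla f(x^k)),\qquad x^{k+1}=x^k-\gamma m^k .$$ Then, for every $k\in\mathbb{N}_0$, $$f(x^k)-f_\star\le\alpha^k(f(x^0)-f_\star),\qquad\text{where }\alpha=\max\{1-\gamma\mu(\beta-2\beta^2),\ \beta+2\beta^2\}.$$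
   Context: $\overline{\mathbb{R}}=\mathbb{R}\cup\{+\infty\}$; $\|\cdot\|$ is the Euclidean norm on $\mathbb{R}^n$; $\phi^*$ is the convex conjugate of $\phi$. Reference function: $\phi:\mathbb{R}^n\to\overline{\mathbb{R}}$ is strongly convex and even with $\phi(0)=0$; $\operatorname{int}\operatorname{dom}\phi\neq\emptyset$; $\phi\in\mathcal{C}^2(\operatorname{int}\operatorname{dom}\phi)$; and for any sequence $\{x^k\}$ (in $\operatorname{int}\operatorname{dom}\phi$, where $\nabla\phi$ is defined) that converges to some boundary point of $\operatorname{int}\operatorname{dom}\phi$, $\|\nabla\phi(x^k)\|\to+\infty$. (Under these conditions $\phi^*\in\mathcal{C}^2(\mathbb{R}^n)$ and the range of $\nabla\phi$ is all of $\mathbb{R}^n$.) $2$-subhomogeneity: $\phi(\theta x)\le\theta^2\phi(x)$ for all $\theta\in[0,1]$ and $x\in\operatorname{dom}\phi$. Episcaling: for $\lambda>0$, $(\lambda\star\phi)(x)=\lambda\phi(\lambda^{-1}x)$. Anisotropic smoothness: $f\in\mathcal{C}^1(\mathbb{R}^n)$ is anisotropically smooth relative to $\phi$ with constant $L>0$ if for all $x,\bar x\in\mathbb{R}^n$ $$f(x)\le f(\bar x)+\left(\tfrac1L\star\phi\right)(x-\bar y)-\left(\tfrac1L\star\phi\right)(\bar x-\bar y),\qquad \bar y=\bar x-\tfrac1L\nabla\phi^*(\nabla f(\bar x)).$$ (The right-hand side may be $+\infty$.) Anisotropic gradient dominance: $f$ satisfies it relative to $\phi$ with constant $\mu>0$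 if for all $x\in\mathbb{R}^n$, $\phi(\nabla\phi^*(\nabla f(x)))\ge\mu(f(x)-f_\star)$. *)

(* Defs.v *)
From mathcomp Require Import all_boot all_order all_algebra.
From mathcomp Require Import all_classical all_reals all_analysis.
Import Order.TTheory GRing.Theory Num.Theory.
Import numFieldNormedType.Exports.

Set Implicit Arguments.
Unset Strict Implicit.
Unset Printing Implicit Defensive.

Local Open Scope classical_set_scope.
Local Open Scope ring_scope.

(* R^n is 'rV[R]_n. The library norm on 'rV[R]_n is the sup norm: it induces
   the usual topology and notion of differentiability, but the Euclidean inner
   product and norm have to be introduced separately. *)
Definition dot (R : realType) (n : nat) (x y : 'rV[R]_n) : R :=
  \sum_(i < n) x 0 i * y 0 i.

Definition enorm (R : realType) (n : nat) (x : 'rV[R]_n) : R :=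
  Num.sqrt (dot x x).

Definition gradient (R : realType) (n : nat) (g : 'rV[R]_n -> R)
    (x : 'rV[R]_n) : 'rV[R]_n :=
  \row_(i < n) 'D_(delta_mx 0 i) g x.

(* C1_on and C2_on are meant for an open set U, on which continuity at every
   point of U is the same as continuity relative to U. *)
Definition C1_on (R : realType) (n : nat) (U : set 'rV[R]_n)
    (g : 'rV[R]_n -> R) : Prop :=
  forall x, U x -> differentiable g x /\ {for x, continuous (gradient g)}.

Definition C2_on (R : realType) (n : nat) (U : set 'rV[R]_n)
    (g : 'rV[R]_n -> R) : Prop :=
  C1_on U g /\
  forall x, U x -> differentiable (gradient g) x /\
                   {for x, continuous (jacobian (gradient g))}.

Definition dom (R : realType) (n : nat) (phi : 'rV[R]_n -> \bar R) :
    set 'rV[R]_n :=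
  [set x | (phi x < +oo)%E].

Definition strongly_convex (R : realType) (n : nat)
    (phi : 'rV[R]_n -> \bar R) : Prop :=
  exists2 sigma : R, 0 < sigma &
    forall (x y : 'rV[R]_n) (t : R), 0 < t < 1 ->
      (phi (t *: x + (1 - t) *: y)%R <=
       t%:E * phi x + (1 - t)%:E * phi y
       - (sigma / 2 * t * (1 - t) * enorm (x - y) ^+ 2)%:E)%E.

(* The field ref_proper states that phi takes its values in R U {+oo}. On the
   interior of dom phi, phi is real-valued and coincides with fine \o phi. *)
Record reference_function (R : realType) (n : nat)
    (phi : 'rV[R]_n -> \bar R) : Prop := ReferenceFunction {
  ref_proper : forall x, phi x != -oo%E;
  ref_strongly_convex : strongly_convex phi;
  ref_even : forall x, phi (- x) = phi x;
  ref_0 : phi 0 = 0%E;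
  ref_int_dom : interior (dom phi) !=set0;
  ref_C2 : C2_on (interior (dom phi)) (fine \o phi);
  ref_boundary : forall (u : nat -> 'rV[R]_n) (b : 'rV[R]_n),
    (forall k, interior (dom phi) (u k)) ->
    (closure (interior (dom phi)) `\` interior (dom phi)) b ->
    u k @[k --> \oo] --> b ->
    enorm (gradient (fine \o phi) (u k)) @[k --> \oo] --> +oo
}.

Definition subhomogeneous2 (R : realType) (n : nat)
    (phi : 'rV[R]_n -> \bar R) : Prop :=
  forall (theta : R) (x : 'rV[R]_n), 0 <= theta <= 1 -> dom phi x ->
    (phi (theta *: x)%R <= (theta ^+ 2)%:E * phi x)%E.

Definition conjugate (R : realType) (n : nat) (phi : 'rV[R]_n -> \bar R)
    (y : 'rV[R]_n) : \bar R :=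
  ereal_sup (range (fun x : 'rV[R]_n => ((dot x y)%:E - phi x)%E)).

(* The conjugate of a reference function is finite everywhere, so that fine
   only casts it to a real-valued function. *)
Definition grad_conjugate (R : realType) (n : nat)
    (phi : 'rV[R]_n -> \bar R) : 'rV[R]_n -> 'rV[R]_n :=
  gradient (fine \o conjugate phi).

Definition episcale (R : realType) (n : nat) (lambda : R)
    (phi : 'rV[R]_n -> \bar R) (x : 'rV[R]_n) : \bar R :=
  (lambda%:E * phi (lambda^-1 *: x)%R)%E.

(* For a reference function, the subtracted term is finite, since
   L (xbar - ybar) = grad phi^* (grad f xbar) lies in the interior of dom phi;
   hence no indeterminate difference of infinities occurs. *)
Definition anisotropically_smooth (R : realType) (n : nat)
    (phi : 'rV[R]_n -> \bar R) (f : 'rV[R]_n -> R) (L : R) : Prop :=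
  forall x xbar : 'rV[R]_n,
    let ybar := xbar - L^-1 *: grad_conjugate phi (gradient f xbar) in
    ((f x)%:E <= (f xbar)%:E + episcale L^-1 phi (x - ybar)%R
                 - episcale L^-1 phi (xbar - ybar)%R)%E.

Definition anisotropic_gradient_dominance (R : realType) (n : nat)
    (phi : 'rV[R]_n -> \bar R) (f : 'rV[R]_n -> R) (mu : R) : Prop :=
  forall x : 'rV[R]_n,
    ((mu * (f x - inf (range f)))%:E
       <= phi (grad_conjugate phi (gradient f x)))%E.

(* The momentum sequence is shifted by one: m k stands for m^{k-1}, so that
   m 0 is m^{-1}. *)
Definition momentum_iterates (R : realType) (n : nat)
    (phi : 'rV[R]_n -> \bar R) (f : 'rV[R]_n -> R) (beta gamma : R)
    (x m : nat -> 'rV[R]_n) : Prop :=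
  m 0%N = 0 /\
  forall k : nat,
    m k.+1 = beta *: m k
             + (1 - beta) *: grad_conjugate phi (gradient f (x k)) /\
    x k.+1 = x k - gamma *: m k.+1.

(* Main.v *)
(* Write d_k for the gradient of phi^* at grad f (x_k). The Lyapunov function
   is V_k = f (x_k) - f_* + gamma phi (m_k), with m_0 = 0 and hence
   V_0 = f (x_0) - f_*. The descent inequality at x_k bounds f (x_(k+1)) through
   phi at the point
     d_k - L gamma m_(k+1) = (1 - L gamma) d_k + L gamma beta (d_k - m_k),
   and convexity, evenness and 2-subhomogeneity give
     phi (beta (d_k - m_k)) <= 2 beta^2 (phi d_k + phi m_k).
   Adding phi (m_(k+1)) <= beta phi m_k + (1 - beta) phi d_k and applying gradient
   dominance to the remaining negative multiple of phi d_k yields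
   V_(k+1) <= alpha V_k. *)
Require Import Defs.
From mathcomp Require Import all_boot all_order all_algebra.
From mathcomp Require Import all_classical all_reals all_analysis.
From mathcomp Require Import ring lra.
Import Order.TTheory GRing.Theory Num.Theory.
Import numFieldNormedType.Exports.
Local Open Scope classical_set_scope.
Local Open Scope ring_scope.

(** Dropping the quadratic gap leaves plain convexity. The real bounds [a] and [b] keep infinite
    values out of later computations. *)
Lemma strongly_convex_le (R : realType) (n : nat) (phi : 'rV[R]_n -> \bar R)
    (x y : 'rV[R]_n) (t a b : R) :
  strongly_convex phi -> 0 <= t <= 1 ->
  (phi x <= a%:E)%E -> (phi y <= b%:E)%E ->
  (phi (t *: x + (1 - t) *: y)%R <= (t * a + (1 - t) * b)%:E)%E.
Proof.
move=> [s s0 cvx] /andP[t0 t1] xa yb.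
have [->|tN0] := eqVneq t 0.
  by rewrite scale0r add0r subr0 scale1r mul0r add0r mul1r.
have [->|tN1] := eqVneq t 1.
  by rewrite subrr !scale0r addr0 scale1r !mul0r addr0 mul1r.
have t01 : 0 < t < 1 by rewrite !lt_neqAle eq_sym tN0 t0 tN1 t1.
apply: le_trans (cvx x y t t01) _.
have gap : 0 <= s / 2 * t * (1 - t) * enorm (x - y) ^+ 2.
  apply: mulr_ge0; last exact: sqr_ge0.
  by rewrite !mulr_ge0 ?invr_ge0 ?subr_ge0// ltW.
apply: (@le_trans _ _ (t%:E * phi x + (1 - t)%:E * phi y)%E).
  by rewrite -[leRHS]adde0 leeD2l// -EFinN lee_fin oppr_le0.
by rewrite [leRHS]EFinD !EFinM leeD// lee_wpmul2l// lee_fin ?subr_ge0.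
Qed.

(** By evenness, [0] is the midpoint of two points with the same value [phi x]. *)
Lemma reference_ge0 (R : realType) (n : nat) (phi : 'rV[R]_n -> \bar R)
    (x : 'rV[R]_n) :
  reference_function phi -> (0 <= phi x)%E.
Proof.
move=> hphi.
case E : (phi x) => [a| |]; last 2 first.
- by rewrite leey.
- by have := ref_proper hphi x; rewrite E.
have := @strongly_convex_le _ _ _ x (- x) 2^-1 a a (ref_strongly_convex hphi).
rewrite (ref_even hphi) E lexx => /(_ _ isT isT).
rewrite (_ : 1 - 2^-1 = 2^-1 :> R); last by field.
rewrite scalerN subrr (ref_0 hphi) !lee_fin => H.
have := H ltac:(lra); lra.
Qed.

(** The vector is [2 * beta] times the midpoint of [x] and [- y]: convexity and evenness bound [phi]
    there by [(a + b) / 2], and 2-subhomogeneity, applicable as [2 * beta <= 1], contributes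
    [4 * beta ^+ 2]. *)
Lemma reference_scale_sub_le (R : realType) (n : nat)
    (phi : 'rV[R]_n -> \bar R) (x y : 'rV[R]_n) (beta a b : R) :
  reference_function phi -> subhomogeneous2 phi -> 0 <= beta <= 2^-1 ->
  (phi x <= a%:E)%E -> (phi y <= b%:E)%E ->
  (phi (beta *: (x - y))%R <= (2 * beta ^+ 2 * (a + b))%:E)%E.
Proof.
move=> hphi hsub hbeta xa yb.
have mid : (phi (2^-1 *: (x - y))%R <= (2^-1 * (a + b))%:E)%E.
  have h := @strongly_convex_le _ _ _ x (- y) 2^-1 a b (ref_strongly_convex hphi).
  rewrite (ref_even hphi) (_ : 1 - 2^-1 = 2^-1 :> R) in h; last by field.
  by rewrite scalerDr mulrDr h//; lra.
have -> : beta *: (x - y) = (2 * beta) *: (2^-1 *: (x - y)).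
  by rewrite scalerA; congr (_ *: _); field.
apply: le_trans (hsub _ _ _ _) _; first by lra.
  by rewrite /dom/=; apply: le_lt_trans mid _; rewrite ltry.
apply: (@le_trans _ _ (((2 * beta) ^+ 2)%:E * (2^-1 * (a + b))%:E)%E).
  by rewrite lee_wpmul2l// lee_fin sqr_ge0.
by rewrite -EFinM lee_fin le_eqVlt; apply/orP; left; apply/eqP; field.
Qed.

(* The indeterminate [+oo - +oo] evaluates to [-oo], so that the smoothness
   inequality itself forces [phi] to be finite at the step direction. *)
Lemma anisotropically_smooth_step (R : realType) (n : nat)
    (phi : 'rV[R]_n -> \bar R) (f : 'rV[R]_n -> R) (L : R) (x : 'rV[R]_n) :
  reference_function phi -> 0 < L -> anisotropically_smooth phi f L ->
  exists q : R,
    phi (grad_conjugate phi (gradient f x)) = q%:E /\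
    forall (v : 'rV[R]_n) (a : R),
      (phi (grad_conjugate phi (gradient f x) - L *: v)%R <= a%:E)%E ->
      f (x - v) <= f x + L^-1 * (a - q).
Proof.
move=> hphi L0 /(_ _ x) /= smooth.
set d := grad_conjugate phi (gradient f x) in smooth *.
have LN0 : L != 0 by rewrite gt_eqF.
(* Scaled by [L], the offsets of [x - v] and [x] from [ybar] are [d - L *: v] and [d]. *)
have step v : ((f (x - v))%:E <=
    (f x)%:E + L^-1%:E * phi (d - L *: v)%R - L^-1%:E * phi d)%E.
  have := smooth (x - v).
  rewrite /episcale !invrK subKr opprB [x - v + _]addrC addrA subrK.
  by rewrite scalerBr !scalerA divff// scale1r.
case E : (phi d) => [q| |]; last 2 first.
- have := step 0.
  by rewrite E gt0_muley ?lte_fin ?invr_gt0//= addeNy leeNy_eq.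
- by have := ref_proper hphi d; rewrite E.
exists q; split=> // v a va.
rewrite mulrBr addrA -lee_fin EFinB EFinD !EFinM -E.
apply: le_trans (step v) _.
by rewrite leeD2r// leeD2l// lee_wpmul2l// lee_fin invr_ge0 ltW.
Qed.

Theorem theorem2p4 (R : realType) (n : nat)
    (phi : 'rV[R]_n -> \bar R) (f : 'rV[R]_n -> R)
    (L mu beta gamma : R) (x m : nat -> 'rV[R]_n)
    (hphi : reference_function phi)
    (hsub : subhomogeneous2 phi)
    (hf : C1_on setT f)
    (hL : 0 < L)
    (hsmooth : anisotropically_smooth phi f L)
    (hinf : has_lbound (range f))
    (hmu : 0 < mu)
    (hdom : anisotropic_gradient_dominance phi f mu)
    (hbeta : 0 < beta < 2^-1)
    (hgamma : 0 < gamma <= L^-1)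
    (hiter : momentum_iterates phi f beta gamma x m) :
  let fstar := inf (range f) in
  let alpha := Num.max (1 - gamma * mu * (beta - 2 * beta ^+ 2))
                       (beta + 2 * beta ^+ 2) in
  forall k : nat, f (x k) - fstar <= alpha ^+ k * (f (x 0%N) - fstar).
Proof.
move=> fstar alpha k.
have [beta0 beta_lt] := andP hbeta; have [gamma0 gammaL] := andP hgamma.
have [m0 rec] := hiter.
(* A real upper bound [p] replaces [phi (m k)] in the Lyapunov function, so the induction stays in
   the reals. *)
suff [p [p0 [_ V]]] : exists p : R, 0 <= p /\ (phi (m k) <= p%:E)%E /\
    f (x k) - fstar + gamma * p <= alpha ^+ k * (f (x 0%N) - fstar).
  by apply: le_trans V; rewrite lerDl mulr_ge0// ltW.
elim: k => [|k [p [p0 [mp V]]]].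
  exists 0; rewrite m0 (ref_0 hphi) lexx mulr0 addr0 expr0 mul1r.
  by split=> //; split.
have [mS xS] := rec k.
have [q [dq step]] := anisotropically_smooth_step _ _ _ _ _ (x k) hphi hL hsmooth.
set d := grad_conjugate phi (gradient f (x k)) in mS dq step.
have dq_le : (phi d <= q%:E)%E by rewrite dq.
have q0 : 0 <= q by rewrite -lee_fin -dq reference_ge0.
have dominance : mu * (f (x k) - fstar) <= q by rewrite -lee_fin -dq hdom.
have gap0 : 0 <= f (x k) - fstar by rewrite subr_ge0 ge_inf//; exists (x k).
have cvx := ref_strongly_convex hphi.
have c01 : 0 <= L * gamma <= 1.
  rewrite mulr_ge0 ?(ltW hL) ?(ltW gamma0)//=.
  by rewrite mulrC -ler_pdivlMr// mul1r.
pose r := 2 * beta ^+ 2 * (q + p).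
have dm : (phi (beta *: (d - m k))%R <= r%:E)%E.
  by apply: reference_scale_sub_le => //; lra.
have descent : f (x k.+1) <= f (x k) + gamma * (r - q).
  (* The weights [L * gamma] and [1 - L * gamma] of the convex combination are made visible. *)
  have -> : gamma * (r - q) =
      L^-1 * (L * gamma * r + (1 - L * gamma) * q - q).
    by field; rewrite gt_eqF.
  rewrite xS; apply: step.
  rewrite (_ : d - _ =
      (L * gamma) *: (beta *: (d - m k)) + (1 - L * gamma) *: d).
    exact: strongly_convex_le.
  by rewrite mS; apply/rowP => i; rewrite !mxE; ring.
exists (beta * p + (1 - beta) * q); split; [|split].
- by rewrite addr_ge0// mulr_ge0// ?subr_ge0; lra.
- by rewrite mS; apply: strongly_convex_le => //; lra.
have beta2 : 0 <= beta - 2 * beta ^+ 2.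
  rewrite (_ : _ - _ = beta * (1 - 2 * beta)); last by ring.
  by rewrite mulr_ge0//; lra.
have a1 : 1 - gamma * mu * (beta - 2 * beta ^+ 2) <= alpha.
  by rewrite /alpha le_max lexx.
have a2 : beta + 2 * beta ^+ 2 <= alpha by rewrite /alpha le_max lexx orbT.
(* This sign allows the induction hypothesis to be multiplied by [alpha]. *)
have alpha0 : 0 <= alpha.
  by apply: le_trans a2; rewrite addr_ge0 ?mulr_ge0 ?sqr_ge0// ltW.
apply: (@le_trans _ _ (alpha * (f (x k) - fstar + gamma * p))); last first.
  by rewrite exprS -mulrA ler_wpM2l.
(* The coefficient of [gamma * q] is [2 * beta ^+ 2 - 1] from descent plus [1 - beta] from the new
   momentum bound; that of [gamma * p] is [2 * beta ^+ 2 + beta]. *)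
apply: (@le_trans _ _ (f (x k) - fstar - gamma * (beta - 2 * beta ^+ 2) * q
    + (beta + 2 * beta ^+ 2) * (gamma * p))).
  by move: descent; rewrite /r; lra.
rewrite [leRHS]mulrDr lerD//; last by rewrite ler_wpM2r// mulr_ge0// ltW.
(* As [beta - 2 * beta ^+ 2] is nonnegative, dominance trades the negative multiple of [q] for one
   of the gap. *)
apply: le_trans (ler_wpM2r gap0 a1).
have := ler_wpM2l (mulr_ge0 (ltW gamma0) beta2) dominance.
lra.
Qed.
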